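(* For a set $X\subseteq\mathbb R$ the following are equivalent: (1) $X$ is an $A_2$-set; (2) for every Borel function $\Psi:X\to{}^{\mathbb N}\mathbb N$, the image $\Psi[X]$ is bounded; (3) for every Borel function $\Psi:X\to{}^{\mathbb N}\mathbb N$, the image $\Psi[X]$ has property $H$.
   Context: $X\subseteq\mathbb R$ is an $A_2$-set if for every sequence $(\mathfrak U_1,\mathfrak U_2,\dots)$ where each $\mathfrak U_n$ is a countable collection of Borel subsets of $\mathbb R$ with $X\subseteq\bigcup\mathfrak U_n$, there is a sequence $(\mathfrak G_1,\mathfrak G_2,\dots)$ with each $\mathfrak G_n$ a finite subset of $\mathfrak U_n$ and $X\subseteq\bigcup_{n=1}^\infty\bigcap_{m=n}^\infty\bigcup\mathfrak G_m$. A function $\Psi:X\to{}^{\mathbb N}\mathbb N$ (Baire space with the product topology) is Borel if the preimage of every open set is of the form $X\cap B$ with $B\subseteq\mathbb R$ Borel. A set $F\subseteq{}^{\mathbb N}\mathbb N$ is bounded if there is $g\in{}^{\mathbb N}\mathbb N$ such that for every $f\in F$, $f(n)<g(n)$ for all but finitely many $n$. A space $Y$ has property $H$ (Hurewicz) if for every sequence $(\mathcal G_n)_n$ of open covers of $Y$ there are finite $\mathcal F_n\subseteq\mathcal G_n$ with $Y\subseteq\bigcup_{n=1}^\infty\bigcap_{m=n}^\infty\bigcup\mathcal F_m$. *)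

(* Defs.v *)
From HB Require Import structures.
From mathcomp Require Import all_boot all_order all_algebra.
From mathcomp Require Import all_classical all_reals all_analysis measurable_realfun.

Set Implicit Arguments.
Unset Strict Implicit.
Unset Printing Implicit Defensive.

Import Order.TTheory GRing.Theory Num.Theory.
Import numFieldNormedType.Exports.

Local Open Scope classical_set_scope.

Definition borel (T : topologicalType) : set (set T) := <<s [set U | open U] >>.

Lemma borelE (R : realType) : @borel R = measurable.
Proof.
rewrite eqEsubset; split.
- apply: smallest_sub; first exact: sigma_algebra_measurable.
  by move=> U oU; exact: open_measurable.
- have -> : @measurable _ R = <<s @RGenOpens.G R >> by exact: RGenOpens.measurableE.
  apply: smallest_sub; first exact: smallest_sigma_algebra.
  move=> _ [x [y ->]]; apply: sub_sigma_algebra; exact: interval_open.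
Qed.

(* Sequences are indexed from 0 instead of 1. *)
Definition A2_set (R : realType) (X : set R) : Prop :=
  forall U : nat -> set (set R),
    (forall n, [/\ countable (U n), U n `<=` @borel R
                 & X `<=` \bigcup_(A in U n) A]) ->
    exists G : nat -> set (set R),
      (forall n, finite_set (G n) /\ G n `<=` U n) /\
      X `<=` \bigcup_n \bigcap_(m >= n) \bigcup_(A in G m) A.

(* Discrete topology on each factor, product topology on functions. *)
Definition baire_space : topologicalType := {ptws nat -> nat}.

(* As with measurable_fun, a function on X is a total function whose values
   outside X are irrelevant. *)
Definition borel_fun (R : realType) (X : set R) (Psi : R -> baire_space) : Prop :=
  forall V : set baire_space, open V ->
    exists2 B : set R, borel B & X `&` Psi @^-1` V = X `&` B.

Definition baire_bounded (F : set baire_space) : Prop :=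
  exists g : baire_space, forall f, F f -> \forall n \near \oo, (f n < g n)%N.

Definition hurewicz (Y : topologicalType) : Prop :=
  forall G : nat -> set (set Y),
    (forall n, G n `<=` [set U | open U] /\ [set: Y] `<=` \bigcup_(U in G n) U) ->
    exists F : nat -> set (set Y),
      (forall n, finite_set (F n) /\ F n `<=` G n) /\
      [set: Y] `<=` \bigcup_n \bigcap_(m >= n) \bigcup_(U in F m) U.

(* The points are those of A only, and its open sets are the traces on A of
   open sets of T; the library's [subspace A] instead keeps every point of T. *)
Definition subspace_of (T : topologicalType) (A : set T) : topologicalType :=
  initial_topology (set_val : A -> T).

Lemma open_subspace_ofE (T : topologicalType) (A : set T)
    (V : set (subspace_of A)) :
  open V <-> exists2 W : set T, open W & V = (set_val : A -> T) @^-1` W.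
Proof. by split=> -[W oW VW]; exists W. Qed.

(* Main.v *)
(** (1) => (3): pulling back along Psi a countable base of Baire space turns
    open covers of Psi[X] into countable Borel covers of X.  (3) => (2): apply
    the Hurewicz property to the covers {f | f n = k}, k in nat, of the image.
    (2) => (1): after disjointifying the n-th cover, mapping x to the sequence
    of indices of the sets containing it is a Borel function, and a bound on
    its image tells how many members of each cover to keep. *)
Require Import Defs.
From mathcomp Require Import all_boot all_order all_algebra.
From mathcomp Require Import all_classical all_reals all_analysis.
Import numFieldNormedType.Exports.
Local Open Scope classical_set_scope.

(** Padding with [set0] allows a total enumeration even when [A] is finite or empty, and leaves
    unions unchanged. *)
Lemma countable_enum (T : Type) (A : set (set T)) : countable A ->
  exists2 E : nat -> set T, A `<=` range E & range E `<=` A `|` [set set0].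
Proof.
move=> /countable_injP[e inje].
exists (fun k => xget set0 [set B | A B /\ e B = k]) => [B AB|_ [k _ <-]].
  exists (e B) => //; case: xgetP => [C _ [AC eCB]|/(_ B)]; last by case.
  by apply: inje; rewrite ?inE.
by case: xgetP => [B _ [AB _]|_]; [left|right].
Qed.

Lemma finite_nat_ub (A : set nat) :
  finite_set A -> exists N, A `<=` [set k | (k < N)%N].
Proof.
move=> /finite_seqP[s ->]; exists (\max_(k <- s) k).+1 => k /= ks.
by rewrite ltnS; exact: leq_bigmax_seq.
Qed.

(** The sequences extending [s]. As [seq nat] is countable, these sets serve as the countable
    base. *)
Definition cylinder (s : seq nat) : set baire_space :=
  \bigcap_(i in `I_(size s)) [set f : baire_space | f i = nth 0%N s i].

Lemma open_coord (n k : nat) : open [set f : baire_space | f n = k].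
Proof.
have [+ _] := continuousP (proj n : baire_space -> nat).
move=> /(_ (@proj_continuous nat (fun=> nat) n) [set k]); apply.
exact: discrete_open.
Qed.

Lemma open_cylinder s : open (cylinder s).
Proof.
rewrite /cylinder bigcap_mkord; apply: big_ind; [exact: openT|exact: openI|].
by move=> i _; exact: open_coord.
Qed.

Lemma cylinder_mkseq (f : baire_space) n : cylinder (mkseq f n) f.
Proof. by move=> i /=; rewrite size_mkseq => ?; rewrite nth_mkseq. Qed.

(** Otherwise each [n] yields some [g n] outside [V] agreeing with [f] below [n]; then [g] converges
    pointwise to [f], so it eventually enters [V]. *)
Lemma cylinder_basis (f : baire_space) (V : set baire_space) :
  open V -> V f -> exists2 s, cylinder s f & cylinder s `<=` V.
Proof.
move=> oV Vf; have fV : nbhs f V by exact: open_nbhs_nbhs.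
apply: contrapT => nV.
have /choice[g gP] n : exists g, cylinder (mkseq f n) g /\ ~ V g.
  apply: contrapT => /forallNP gV; apply: nV.
  exists (mkseq f n) => [|g cg]; first exact: cylinder_mkseq.
  by apply: contrapT => Vg; apply: (gV g).
have gf : {ptws, g @ \oo --> f}.
  apply/pointwise_cvgP => t; apply: cvg_near_cst.
  change (\forall n \near \oo, g n t = f t); near=> n.
  have [/(_ t) + _] := gP n; rewrite /= size_mkseq.
  have tn : (t < n)%N by near: n; exact: nbhs_infty_gt.
  by move=> /(_ tn); rewrite nth_mkseq.
have [N _ /(_ N (leqnn N))] := gf V fV.
by have [] := gP N.
Unshelve. all: by end_near. Qed.

Lemma borel_fun_coord (R : realType) (X : set R) (Psi : R -> baire_space) :
  (forall n k, exists2 B : set R, borel B &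
    X `&` [set x | Psi x n = k] = X `&` B) ->
  borel_fun X Psi.
Proof.
move=> coordX V oV.
have /choice[B BP] (p : nat * nat) : exists B : set R,
    borel B /\ X `&` [set x | Psi x p.1 = p.2] = X `&` B.
  by have [B bB XB] := coordX p.1 p.2; exists B.
have inB x n k : X x -> B (n, k) x <-> Psi x n = k.
  have [_ /seteqP[XB BX]] := BP (n, k).
  move=> Xx; split=> [Bx|Pxn]; first by have [] := BX x (conj Xx Bx).
  by have [] := XB x (conj Xx Pxn).
(* [V] is the union of the cylinders it contains: a countable union of finite intersections of
   coordinate conditions. *)
exists (\bigcup_(s in [set s | cylinder s `<=` V])
    \bigcap_(i in `I_(size s)) B (i, nth 0%N s i)).
  rewrite borelE bigcup_mkcond; apply: countable_bigcupT_measurable => // s.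
  case: ifP => // _; apply: fin_bigcap_measurable; first exact: finite_II.
  by move=> i _; rewrite -borelE; have [] := BP (i, nth 0%N s i).
apply/seteqP; split=> x [Xx].
  move=> /(cylinder_basis _ _ oV)[s sx sV].
  by split=> //; exists s => // i /sx /= si; apply/inB.
move=> [s /= sV Bx]; split=> //; apply: sV => i /= si.
by apply/inB => //; exact: Bx.
Qed.

Lemma hurewicz_bounded (F : set baire_space) :
  hurewicz (subspace_of F) -> baire_bounded F.
Proof.
move=> /(_ (fun n => range (fun k => set_val @^-1` [set f | f n = k])))[n|H].
  split=> [_ [k _ <-]|y _].
    by apply/open_subspace_ofE; eexists; first exact: (open_coord n k).
  by exists (set_val @^-1` [set f | f n = set_val y n]) => //; eexists.
move=> [HP Hcov].
have /choice[g gP] n : exists N,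
    forall U y, H n U -> U y -> (set_val y n < N)%N.
  have [finH HG] := HP n.
  (* Reads the value off the set: an empty [U] may fit several values, but a point of [U] forces a
     single one. *)
  pose k (U : set (subspace_of F)) := xget 0%N
    [set k | U = set_val @^-1` [set f : baire_space | f n = k]].
  have [N kN] := finite_nat_ub (k @` H n) (finite_image k finH).
  exists N => U y HU Uy; have [j _ Uj] := HG U HU.
  suff -> : set_val y n = k U by apply: kN; exists U.
  rewrite /k; case: xgetP => [i _ /= Ui|/(_ j)/=]; last by rewrite Uj.
  by move: Uy; rewrite Ui.
exists g => f Ff.
have [n _ fH] := Hcov (exist _ f (mem_set Ff)) I.
exists n => // m /= nm; have [U HU Uf] := fH m nm.
exact: (gP m U _ HU Uf).
Qed.

Lemma A2_hurewicz (R : realType) (X : set R) (Psi : R -> baire_space) :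
  A2_set X -> borel_fun X Psi -> hurewicz (subspace_of (Psi @` X)).
Proof.
move=> A2X bPsi G GP.
have /choice[B BP] s : exists B : set R,
    borel B /\ X `&` Psi @^-1` cylinder s = X `&` B.
  by have [B bB XB] := bPsi (cylinder s) (open_cylinder s); exists B.
have inB x s : X x -> B s x <-> cylinder s (Psi x).
  have [_ /seteqP[XB BX]] := BP s.
  move=> Xx; split=> [Bx|sx]; first by have [] := BX x (conj Xx Bx).
  by have [] := XB x (conj Xx sx).
(* Refinement of the cover [G n], possibly uncountable, by countably many cylinders. *)
pose D n s := exists2 U, G n U &
  forall y : subspace_of (Psi @` X), cylinder s (set_val y) -> U y.
have [n|H [HP Hcov]] := A2X (fun n => B @` D n).
  split; first exact: (sub_countable (card_image_le _ _)).
    by move=> _ [s _ <-]; have [] := BP s.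
  move=> x Xx; have [Gopen Gcov] := GP n.
  have PXx : (Psi @` X) (Psi x) by exists x.
  have [U GU Ux] := Gcov (exist _ (Psi x) (mem_set PXx)) I.
  have /open_subspace_ofE[W oW UW] := Gopen U GU.
  move: Ux; rewrite UW => /(cylinder_basis _ _ oW)[s sx sW].
  exists (B s); last exact/inB.
  by exists s => //; exists U => // y /sW; rewrite UW.
(* [A] may be [B s] for several [s], so the member of [G n] is chosen from [A] alone, as one
   containing the image of the part of [A] in [X]. *)
pose v n A := xget set0 [set U | G n U /\
  forall y : subspace_of (Psi @` X),
    (exists x, [/\ X x, A x & Psi x = set_val y]) -> U y].
have vP n A : (B @` D n) A -> G n (v n A) /\
  forall y : subspace_of (Psi @` X),
    (exists x, [/\ X x, A x & Psi x = set_val y]) -> v n A y.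
  move=> [s [U GU sU] <-]; rewrite /v; case: xgetP => // /(_ U)[].
  split=> // y [x [Xx Bx xy]]; apply: sU; rewrite -xy; exact/inB.
exists (fun n => v n @` H n); split=> [n|y _].
  have [finH HD] := HP n; split; first exact: finite_image.
  by move=> _ [A /HD/vP[GA _] <-].
have [x Xx xy] : (Psi @` X) (set_val y) by exact: set_valP.
have [n _ xH] := Hcov x Xx; exists n => // m nm.
have [A HA Ax] := xH m nm; exists (v m A); first by exists A.
by have [_ HD] := HP m; have [_] := vP m A (HD A HA); apply; exists x.
Qed.

Lemma bounded_A2 (R : realType) (X : set R) :
  (forall Psi : R -> baire_space,
     borel_fun X Psi -> baire_bounded (Psi @` X)) ->
  A2_set X.
Proof.
move=> bX U UP.
have /choice[E EP] n : exists E : nat -> set R,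
    U n `<=` range E /\ range E `<=` U n `|` [set set0].
  by have [/countable_enum[E]] := UP n; exists E.
have mE n k : measurable (E n k).
  rewrite -borelE; have [_ bU _] := UP n.
  have [/bU//|->] : (U n `|` [set set0]) (E n k) by apply: (EP n).2; exists k.
  by rewrite borelE.
(* Index of the disjointified piece containing [x]; the default 0 occurs only outside [X], since
   [E n] covers [X]. *)
pose Psi x : baire_space := fun n => xget 0%N [set k | seqDU (E n) k x].
have PsiP x n : X x -> seqDU (E n) (Psi x n) x.
  move=> Xx; rewrite /Psi; case: xgetP => [k _ //|noE].
  have [_ _ /(_ x Xx)[A UA Ax]] := UP n.
  have [k _ EkA] := (EP n).1 A UA.
  have : (\bigcup_k E n k) x by exists k => //; rewrite EkA.
  by rewrite seqDU_bigcup_eq => -[j _ /noE].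
have [|g gP] := bX Psi.
  apply: borel_fun_coord => n k; exists (seqDU (E n) k).
    by rewrite borelE; apply: measurableD => //; exact: bigsetU_measurable.
  apply/seteqP; split=> x [Xx /=]; first by move=> <-; split=> //; exact: PsiP.
  (* Disjointness makes the index unique, so on [X] the fibre over [k] is exactly the [k]-th
     piece. *)
  move=> kx; split=> //; have nx := PsiP x n Xx.
  by apply: (trivIset_seqDU (E n)) => //; exists x.
(* Intersecting with [U n] discards the padding [set0], which may lie outside [U n]; no point of [X]
   is lost. *)
exists (fun n => U n `&` E n @` `I_(g n)); split=> [n|x Xx].
  split; last exact: subIsetl.
  by apply: finite_setIr; exact/finite_image/finite_II.
have [n _ xg] := gP (Psi x) (ex_intro2 _ _ x Xx erefl).
exists n => // m nm; have [Ex _] := PsiP x m Xx.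
exists (E m (Psi x m)) => //; split; last by exists (Psi x m) => //; exact: xg.
have [//|E0] : (U m `|` [set set0]) (E m (Psi x m)).
  by apply: (EP m).2; exists (Psi x m).
by move: Ex; rewrite E0.
Qed.

Theorem theorem3 (R : realType) (X : set R) :
  [<-> A2_set X;
       forall Psi : R -> baire_space,
         borel_fun X Psi -> baire_bounded (Psi @` X);
       forall Psi : R -> baire_space,
         borel_fun X Psi -> hurewicz (subspace_of (Psi @` X))].
Proof.
(* The listed order runs opposite to the cycle of the three lemmas, so each implication composes two
   of them. *)
tfae=> [A2X Psi bPsi|bX Psi|hX].
- exact/hurewicz_bounded/A2_hurewicz.
- exact/A2_hurewicz/bounded_A2.
- by apply: bounded_A2 => Psi /hX/hurewicz_bounded.
Qed.
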